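(* Let $(X,d)$ be a complete separable metric space. Let $S$ be a topological space, $\mathcal{A}$ a $\sigma$-algebra on $S$ containing all open subsets of $S$, and $\mu:\mathcal{A}\to\mathbb{R}$ a strictly positive finite measure, i.e. $\mu(S)<+\infty$ and $\mu(U)>0$ for every (nonempty) open $U\subseteq S$; assume that $(S,\mathcal{A},\mu)$ is complete. Let $M:S\rightrightarrows X$ be an outer-semicontinuous set-valued map, and let $T:S\to S$ be an ergodic measure preserving transformation. Let $g:X\to\mathbb{R}\cup\{+\infty\}$ be lower semicontinuous, and let $g_n:X\to\mathbb{R}\cup\{+\infty\}$, $n\in\mathbb{N}$, be lower semicontinuous functions converging continuously to $g$. Put $M_a:=\bigcap_{s\in S}M(s)$ and $I_n(s):=\bigcap_{k=1}^nM(T^k(s))$ for $s\in S$, $n\ge1$. Assume that the problem of minimizing $g$ over $M_a$ is feasible (there is $x\in M_a$ with $g(x)<+\infty$), and that for $\mu$-almost every $s\in S$ the sequence $(g_n)$ is eventually level-compact on $(I_n(s))_n$. Then: (a) $\lim_{n\to\infty}v(g_n,I_n(s))=v(g,M_a)$ for $\mu$-almost every $s$. (b) For any sequence of measurable functions $\epsilon_n:S\to(0,+\infty)$ with $\epsilon_n(s)\to0$ for $\mu$-almost every $s$, $$\emptyset\ne\limsup_{n\to\infty}\ \epsilon_n(s)\text{-}\mathrm{argmin}_{I_n(s)}\,g_n\subseteq\mathrm{argmin}_{M_a}\,g\quad\text{for }\mu\text{-almost every }s.$$ (c) For $\mu$-almost every $s$, $$\bigcap_{\epsilon>0}\liminf_{n\to\infty}\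 \epsilon\text{-}\mathrm{argmin}_{I_n(s)}\,g_n=\mathrm{argmin}_{M_a}\,g=\bigcap_{\epsilon>0}\limsup_{n\to\infty}\ \epsilon\text{-}\mathrm{argmin}_{I_n(s)}\,g_n.$$
   Context: A set-valued map $M:S\rightrightarrows X$ assigns to each $s$ a subset $M(s)\subseteq X$; it is outer-semicontinuous if for every net $s_\nu\to s$ in $S$ and every net $x_\nu\in M(s_\nu)$ with $x_\nu\to x$ one has $x\in M(s)$. A measurable map $T:S\to S$ is measure preserving if $\mu(T^{-1}(A))=\mu(A)$ for all $A\in\mathcal{A}$; it is ergodic if for all $A\in\mathcal{A}$, $A=T^{-1}(A)$ implies $\mu(A)=0$ or $\mu(A^c)=0$. An ergodic measure preserving transformation is a measurable map satisfying both. $T^k$ is the $k$-fold composition of $T$. Functions $h_n:X\to\mathbb{R}\cup\{+\infty\}$ converge continuously to $h$ if $\lim_n h_n(x_n)=h(x)$ for every $x\in X$ and every sequence $x_n\to x$. A sequence of functions $h_n$ is eventually level-compact on a sequence of sets $C_n\subseteq X$ if for each $\alpha\in\mathbb{R}$ there is $n_\alpha\in\mathbb{N}$ such that $\bigcup_{n\ge n_\alpha}\{x\in C_n: h_n(x)\le\alpha\}$ is relatively compact. For $h:X\to\mathbb{R}\cup\{+\infty\}$, $C\subseteq X$ and $\epsilon\ge0$: $v_\epsilon(h,C):=\inf_C h+\epsilon$ if $\inf_C h>-\infty$, and $v_\epsilon(h,C):=-1/\epsilon$ if $\inf_C h=-\infty$, with the convention $1/0=+\infty$; $\epsilon\text{-}\mathrm{argmin}_C\,h:=\{x\in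 C:h(x)\le v_\epsilon(h,C)\}$. When $\epsilon=0$ the symbol $\epsilon$ is omitted: $v(h,C)=\inf_C h$ and $\mathrm{argmin}_C\,h=\{x\in C:h(x)\le\inf_C h\}$. For sets $S_n\subseteq X$, the Painlevé–Kuratowski limits are $\liminf_{n\to\infty}S_n:=\{x\in X:\limsup_{n\to\infty}d(x,S_n)=0\}$ and $\limsup_{n\to\infty}S_n:=\{x\in X:\liminf_{n\to\infty}d(x,S_n)=0\}$, where $d(x,S_n)=\inf\{d(x,y):y\in S_n\}$ and $\inf\emptyset=+\infty$. The space $S$ is nonempty. *)

(* Defs.v *)
From HB Require Import structures.
From mathcomp Require Import all_boot all_order all_algebra.
From mathcomp Require Import all_classical all_reals all_analysis.

Set Implicit Arguments.
Unset Strict Implicit.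
Unset Printing Implicit Defensive.

Import Order.TTheory GRing.Theory Num.Theory.
Import numFieldNormedType.Exports.

Local Open Scope classical_set_scope.
Local Open Scope ring_scope.
Local Open Scope ereal_scope.

#[short(type="completeMetricType")]
HB.structure Definition CompleteMetric (R : numDomainType) :=
  {T of Complete T & Metric R T}.

(* The topology and the sigma-algebra are a priori unrelated: that open sets
   are measurable is a hypothesis wherever it is needed. *)
#[short(type="topologicalMeasurableType")]
HB.structure Definition TopologicalMeasurable (d : measure_display) :=
  {T of Topological T & Measurable d T}.

Definition separable_space (X : topologicalType) :=
  exists2 D : set X, countable D & dense D.

(* Nets, indexed by a nonempty directed preorder [le] on [D]; [net_filter le]
   is the filter of eventual subsets of [D], so that [u @ net_filter le --> l]
   is the usual convergence of the net [u]. *)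
Section nets.
Variables (D : Type) (le : D -> D -> Prop).

Definition directed_preorder :=
  [/\ inhabited D, (forall i, le i i),
      (forall i j k, le i j -> le j k -> le i k) &
      (forall i j, exists k, le i k /\ le j k)].

Definition net_filter : set_system D :=
  [set P | exists i0, forall i, le i0 i -> P i].

End nets.

Definition outer_semicontinuous (S X : topologicalType) (M : S -> set X) :=
  forall (D : Type) (le : D -> D -> Prop) (s_ : D -> S) (x_ : D -> X) s x,
    directed_preorder le ->
    s_ @ net_filter le --> s ->
    (forall i, M (s_ i) (x_ i)) ->
    x_ @ net_filter le --> x ->
    M s x.

Section ergodicity.
Context {d : measure_display} {S : measurableType d} {R : realType}.
Variable mu : {measure set S -> \bar R}.

Definition measure_preserving (T : S -> S) :=
  measurable_fun [set: S] T /\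
  forall A, measurable A -> mu (T @^-1` A) = mu A.

Definition ergodic (T : S -> S) :=
  forall A, measurable A -> A = T @^-1` A -> mu A = 0 \/ mu (~` A) = 0.

End ergodicity.

Section epiconvergence.
Context {R : realType}.

Definition converges_continuously (X : topologicalType)
    (h_ : nat -> X -> \bar R) (h : X -> \bar R) :=
  forall (x : X) (x_ : nat -> X),
    x_ @ \oo --> x -> h_ n (x_ n) @[n --> \oo] --> h x.

Definition eventually_level_compact (X : topologicalType)
    (h_ : nat -> X -> \bar R) (C_ : nat -> set X) :=
  forall a : R, exists na : nat,
    precompact (\bigcup_(n in [set n | (na <= n)%N])
                  [set x | C_ n x /\ h_ n x <= a%:E]).

Definition value (X : Type) (h : X -> \bar R) (C : set X) : \bar R :=
  ereal_inf (h @` C).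

(* [inve] satisfies 0^-1 = +oo, so that [eps_value 0 h C] is -oo when the
   infimum is -oo. *)
Definition eps_value (X : Type) (eps : R) (h : X -> \bar R) (C : set X) :
    \bar R :=
  if value h C == -oo then - (eps%:E)^-1 else value h C + eps%:E.

Definition eps_argmin (X : Type) (eps : R) (h : X -> \bar R) (C : set X) :
    set X :=
  [set x | C x /\ h x <= eps_value eps h C].

Definition argmin (X : Type) (h : X -> \bar R) (C : set X) : set X :=
  [set x | C x /\ h x <= value h C].

Lemma eps_value0 (X : Type) (h : X -> \bar R) (C : set X) :
  eps_value 0%R h C = value h C.
Proof. by rewrite /eps_value inve0 adde0; case: eqP. Qed.

Lemma eps_argmin0 (X : Type) (h : X -> \bar R) (C : set X) :
  eps_argmin 0%R h C = argmin h C.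
Proof. by rewrite /eps_argmin eps_value0. Qed.

End epiconvergence.

Section painleve_kuratowski.
Context {R : realType} {X : metricType R}.

(* The infimum is +oo when [A] is empty. *)
Definition set_dist (x : X) (A : set X) : \bar R :=
  ereal_inf [set (mdist x y)%:E | y in A].

Definition PK_liminf (S_ : nat -> set X) : set X :=
  [set x | limn_esup (fun n => set_dist x (S_ n)) = 0].

Definition PK_limsup (S_ : nat -> set X) : set X :=
  [set x | limn_einf (fun n => set_dist x (S_ n)) = 0].

End painleve_kuratowski.

Definition almost_sure_set (S X : Type) (M : S -> set X) : set X :=
  \bigcap_(s in [set: S]) M s.

Definition orbit_set (S X : Type) (M : S -> set X) (T : S -> S) (n : nat)
    (s : S) : set X :=
  \bigcap_(k in [set k | (1 <= k <= n)%N]) M (iter k T s).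

(* Main.v *)
(* Outer semicontinuity gives, for each x outside [almost_sure_set M], a
   neighborhood V of x and an open nonempty U such that M u misses V for all
   u in U. By ergodicity almost every orbit visits U, so its sets
   [orbit_set M T n s] eventually miss V. The space X being Lindelof, countably
   many such V suffice: almost surely, the upper limit of the orbit sets is
   contained in [almost_sure_set M], which is itself contained in each of them.
   For a fixed such s, continuous convergence and level-compactness then give
   the conclusions by compactness arguments. *)

Require Import Defs.
From HB Require Import structures.
From mathcomp Require Import all_boot all_order all_algebra.
From mathcomp Require Import all_classical all_reals all_analysis.

Set Implicit Arguments.
Unset Strict Implicit.
Unset Printing Implicit Defensive.

Import Order.TTheory GRing.Theory Num.Theory.
Import numFieldNormedType.Exports.

Local Open Scope classical_set_scope.
Local Open Scope ring_scope.
Local Open Scope ereal_scope.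

(** If every product neighborhood of [x] and [s] met the graph of [M], its graph points would form a
    net converging to [x] and [s], and outer semicontinuity would give [M s x]. *)
Lemma outer_semicontinuous_near (S X : topologicalType) (M : S -> set X)
    (s : S) (x : X) : outer_semicontinuous M -> ~ M s x ->
  \forall y \near x & u \near s, ~ M u y.
Proof.
move=> M_osc; apply: contra_notP => Mmeet.
(* Each index carries two neighborhoods and a graph point in them, so the net needs no choice; [le]
   compares only the neighborhoods, by reverse inclusion. *)
pose D := {i : (set X * set S) * (X * S) |
  [/\ nbhs x i.1.1, nbhs s i.1.2, i.1.1 i.2.1, i.1.2 i.2.2 & M i.2.2 i.2.1]}.
pose le (i j : D) :=
  (sval j).1.1 `<=` (sval i).1.1 /\ (sval j).1.2 `<=` (sval i).1.2.
have inD A B : nbhs x A -> nbhs s B ->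
    exists i : D, (sval i).1 = (A, B).
  move=> xA sB; apply: contrapT => noi; apply: Mmeet.
  exists (A, B) => // -[y u] /= [Ay Bu] Muy; apply: noi.
  have Pi : [/\ nbhs x ((A, B), (y, u)).1.1, nbhs s ((A, B), (y, u)).1.2,
    ((A, B), (y, u)).1.1 ((A, B), (y, u)).2.1,
    ((A, B), (y, u)).1.2 ((A, B), (y, u)).2.2 &
    M ((A, B), (y, u)).2.2 ((A, B), (y, u)).2.1] by [].
  by exists (exist _ ((A, B), (y, u)) Pi).
apply: (M_osc D le (fun i => (sval i).2.2) (fun i => (sval i).2.1)).
- split.
  + by have [i _] := inD _ _ (@filterT _ (nbhs x) _) (@filterT _ (nbhs s) _);
      split.
  + by move=> i; split.
  + by move=> i j k [ij1 ij2] [jk1 jk2]; split;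
      [exact: subset_trans ij1|exact: subset_trans ij2].
  + move=> [i [i1 i2 ? ? ?]] [j [j1 j2 ? ? ?]].
    have [k kE] := inD _ _ (filterI i1 j1) (filterI i2 j2).
    by exists k; split; split; rewrite kE => z [].
- move=> W sW; have [i iE] := inD _ _ (@filterT _ (nbhs x) _) sW.
  exists i => -[j jP] [_ /=]; rewrite iE => /= jW.
  by apply: jW; case: jP.
- by move=> [i []].
- move=> W xW; have [i iE] := inD _ _ xW (@filterT _ (nbhs s) _).
  exists i => -[j jP] [/= + _]; rewrite iE => /= jW.
  by apply: jW; case: jP.
Qed.

(** * Recurrence of ergodic transformations *)

Section recurrence.
Context {d : measure_display} {S : measurableType d} {R : realType}.
Variables (mu : {finite_measure set S -> \bar R}) (T : S -> S).
Hypotheses (T_preserving : measure_preserving mu T) (T_ergodic : ergodic mu T).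

(* The set of points that visit [A] infinitely often is strictly
   [T]-invariant, and has measure at least [mu A]. *)
Lemma ergodic_ae_visit (A : set S) : measurable A -> 0 < mu A ->
  {ae mu, forall s, exists2 k, (1 <= k)%N & A (iter k T s)}.
Proof.
move=> mA muA; have [mT muT] := T_preserving.
pose B N := \bigcup_(k in [set k | (N <= k)%N]) (iter k T @^-1` A).
have mTpre C : measurable C -> measurable (T @^-1` C).
  by move=> mC; rewrite -[X in measurable X]setTI; exact: mT.
have mit k : measurable (iter k T @^-1` A).
  elim: k => [//|k /mTpre]; rewrite (_ : T @^-1` _ = iter k.+1 T @^-1` A)//.
  by apply/funext => s /=; rewrite -iterSr.
have mB N : measurable (B N) by exact: bigcup_measurable.
have BS N : T @^-1` B N = B N.+1.
  apply/seteqP; split=> s.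
    by case=> k /= Nk; rewrite -iterSr => As; exists k.+1.
  by case=> -[//|k] /= Nk As; exists k => //; rewrite /= -iterSr.
have muB N : mu (B N) = mu (B 0%N).
  by elim: N => [//|N <-]; rewrite -BS muT.
have mcap : measurable (\bigcap_n B n) by exact: bigcap_measurable.
have Bhomo : {homo B : n m / (n <= m)%N >-> (m <= n)%O}.
  move=> n m nm; apply/subsetPset => s [k /= mk As]; exists k => //=.
  exact: leq_trans mk.
have mucap : mu (\bigcap_n B n) = mu (B 0%N).
  have B0fin : mu (B 0%N) < +oo by rewrite ltey_eq fin_num_measure.
  have := nonincreasing_cvg_mu B0fin mB mcap Bhomo.
  have -> : mu \o B = cst (mu (B 0%N)) by apply/funext => n /=; exact: muB.
  by move=> /(cvg_unique (@ereal_hausdorff R)) /(_ (cvg_cst _)).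
(* The preimage intersects the sets [B n.+1], and dropping [B 0] from a decreasing intersection
   changes nothing. *)
have inv : \bigcap_n B n = T @^-1` \bigcap_n B n.
  rewrite preimage_bigcap; apply/seteqP; split=> s Bs n _.
    by rewrite BS; exact: Bs.
  by have /subsetPset := Bhomo _ _ (leqnSn n); apply; rewrite -BS; exact: Bs.
have [|muC0] := T_ergodic mcap inv.
  have AB : A `<=` B 0%N by move=> s As; exists 0%N.
  have : mu A <= mu (\bigcap_n B n) by rewrite mucap le_measure// inE.
  by move=> /lt_le_trans - /(_ _ muA) /[swap] ->; rewrite ltxx.
exists (~` \bigcap_n B n); split => //; first exact: measurableC.
(* Infinitely many visits include one at a time at least 1. *)
move=> s /=; apply: contra_not => /(_ 1%N I) [k /= k1 As].
by exists k.
Qed.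

End recurrence.

(** * Set limits and continuous convergence in terms of neighborhoods *)

(** A set misses the ball of radius [e] around [x] exactly when its distance to [x] is at least [e].
    The filter form suits compactness arguments. *)
Lemma PK_limsupP (R : realType) (X : metricType R) (S_ : nat -> set X)
    (x : X) :
  PK_limsup S_ x <-> ~ \forall y \near x & n \near \oo, ~ S_ n y.
Proof.
rewrite /PK_limsup/= limn_einf_lim.
have einf_ge0 n : 0 <= einfs (fun n => set_dist x (S_ n)) n.
  apply: le_ereal_inf_tmp => _ [m _ <-].
  by apply: le_ereal_inf_tmp => _ [y _ <-]; rewrite lee_fin mdist_ge0.
split.
  move=> lim0 [[V N] /= [/nbhs_ballP[e /= e0 xeV] [N' _ NN'] VN]].
  have : e%:E <= limn (einfs (fun n => set_dist x (S_ n))).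
    apply: lime_ge; first exact: is_cvg_einfs.
    exists N' => // n /= N'n.
    apply: le_ereal_inf_tmp => _ [m /= nm <-].
    apply: le_ereal_inf_tmp => _ [y Sy <-]; rewrite lee_fin leNgt.
    apply/negP => xy; apply: (VN (y, m)) Sy; split => /=.
      by apply: xeV; rewrite ballEmdist.
    by apply: NN' => /=; exact: leq_trans nm.
  by rewrite lim0 lee_fin leNgt e0.
move=> freq; apply/eqP; rewrite eq_le; apply/andP; split; last first.
  by apply: lime_ge; [exact: is_cvg_einfs|exact: nearW].
apply/lee_addgt0Pr => e e0; rewrite add0e.
apply: lime_le; first exact: is_cvg_einfs.
apply: nearW => n; rewrite leNgt; apply/negP => en; apply: freq.
exists (ball x e, [set m | (n <= m)%N]).
  by split; [exact: nbhsx_ballx|exists n].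
move=> [y m] /= [xy nm] Sy; move: en; rewrite ltNge => /negP; apply.
apply: ge_ereal_inf; exists (set_dist x (S_ m)); first by exists m.
apply: ge_ereal_inf; exists (mdist x y)%:E; first by exists y.
by move: xy; rewrite ballEmdist lee_fin => /ltW.
Qed.

Lemma PK_liminf_sub_limsup (R : realType) (X : metricType R)
    (S_ : nat -> set X) : PK_liminf S_ `<=` PK_limsup S_.
Proof.
move=> x; rewrite /PK_liminf /PK_limsup /= => lim0.
apply/eqP; rewrite eq_le -{1}lim0 limn_einf_sup /= limn_einf_lim.
apply: lime_ge; first exact: is_cvg_einfs.
apply: nearW => n; apply: le_ereal_inf_tmp => _ [m _ <-].
by apply: le_ereal_inf_tmp => _ [y _ <-]; rewrite lee_fin mdist_ge0.
Qed.

Lemma near_mem_PK_liminf (R : realType) (X : metricType R)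
    (S_ : nat -> set X) (x : X) :
  (\forall n \near \oo, S_ n x) -> PK_liminf S_ x.
Proof.
move=> Sx; rewrite /PK_liminf /=.
suff /cvg_limn_einf_sup[] : set_dist x (S_ n) @[n --> \oo] --> (0 : \bar R) by [].
apply: cvg_near_cst; near=> n.
apply/eqP; rewrite eq_le; apply/andP; split.
  apply: ge_ereal_inf; exists (mdist x x)%:E; last by rewrite mdistxx.
  by exists x => //; near: n.
by apply: le_ereal_inf_tmp => _ [y _ <-]; rewrite lee_fin mdist_ge0.
Unshelve. all: by end_near. Qed.

(** Otherwise bad points exist arbitrarily close to [x] at arbitrarily large indices; completed by
    [x] itself, they make one sequence converging to [x] that violates continuous convergence. *)
Lemma converges_continuously_near (R : realType) (X : pseudoMetricType R)
    (h_ : nat -> X -> \bar R) (h : X -> \bar R) (x : X) (W : set (\bar R)) :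
  converges_continuously h_ h -> nbhs (h x) W ->
  \forall y \near x & n \near \oo, W (h_ n y).
Proof.
move=> cc hxW; apply: contrapT => freq.
pose bad k n := [set y | ball x k.+1%:R^-1%R y /\ ~ W (h_ n y)].
have badP k N : exists n, (N <= n)%N /\ bad k n !=set0.
  apply: contrapT => nobad; apply: freq.
  exists (ball x k.+1%:R^-1%R, [set n | (N <= n)%N]).
    by split; [exact: nbhsx_ballx|exists N].
  move=> [y n] /= [xy Nn]; apply: contrapT => Why; apply: nobad.
  by exists n; split => //; exists y.
have {badP}/choice[next nextP] : forall kN : nat * nat, exists n,
    (kN.2 <= n)%N /\ bad kN.1 n !=set0 by case=> k N; exact: badP.
(* Each [n_ k] lies beyond the previous one, so an index belongs to at most one stage [k]. *)
pose n_ := fix n_ k := next (k, if k is k'.+1 then (n_ k').+1 else 0%N).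
have n_bad k : bad k (n_ k) !=set0 by case: k => [|k]; apply: (nextP (_, _)).2.
have n_incr : {homo n_ : i j / (i < j)%N}.
  by apply: homo_ltn => [? ? ?|k]; [exact: ltn_trans|exact: (nextP (_, _)).1].
(* The default value [x] fills the indices outside the range of [n_]. *)
pose x_ n := xget x [set y | exists2 k, n_ k = n & bad k n y].
have x_near k n : (n_ k <= n)%N -> ball x k.+1%:R^-1%R (x_ n).
  rewrite /x_ => kn; case: xgetP => [y _ [j jn [xy _]]|_]; last exact: ballxx.
  apply: le_ball xy; rewrite lef_pV2 ?posrE// ler_nat ltnS leqNgt.
  by apply/negP => /n_incr; rewrite jn ltnNge kn.
have /cc /(_ _ hxW) [N _ NW] : x_ @ \oo --> x.
  apply/cvg_ballP => e e0.
  have [k _ /(_ k (leqnn k)) ke] := near_infty_natSinv_lt (PosNum e0).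
  exists (n_ k) => // n /= kn; apply: le_ball (x_near _ _ kn).
  exact: ltW.
have n_ge k : (k <= n_ k)%N.
  by elim: k => [//|k]; move=> kn; exact: leq_ltn_trans kn (n_incr _ _ (leqnn _)).
have [y Ny] := n_bad N.
have := NW (n_ N) (n_ge N); rewrite /= /x_.
by case: xgetP => [z _ [j _ []]//|/(_ y)[]]; exists N.
Qed.

(** * Deterministic minimization over sets [C_ n] that contain [C] and have their upper limit in
    [C] *)

Section constrained_minimization.
Context {R : realType} {X : metricType R}.
Variables (g : X -> \bar R) (g_ : nat -> X -> \bar R).
Variables (C : set X) (C_ : nat -> set X).
Hypotheses (g_gtNy : forall x, -oo < g x) (g_lsc : lower_semicontinuous g).
Hypothesis gn_cvg : converges_continuously g_ g.
Hypothesis C_sub : forall n, C `<=` C_ n.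
Hypothesis C_limsup : forall x, ~ C x -> \forall y \near x & n \near \oo, ~ C_ n y.
Hypothesis gn_level_compact : eventually_level_compact g_ C_.
Hypothesis feasible : exists x, C x /\ g x < +oo.

Lemma cvg_pointwise (x : X) : g_ n x @[n --> \oo] --> g x.
Proof. by apply: (gn_cvg (x_ := cst x)); exact: cvg_cst. Qed.

Lemma near_value_lt b : value g C < b ->
  \forall n \near \oo, value (g_ n) (C_ n) < b.
Proof.
move=> /ereal_inf_lt[_ [x Cx <-] gxb].
have : \forall n \near \oo, g_ n x < b by exact: cvg_pointwise (open_ereal_lt' gxb).
apply: filterS => n /= gnb.
by apply: le_lt_trans gnb; apply: ereal_inf_lbound; exists x => //; exact: C_sub.
Qed.

Lemma near_gt_on_C_ a (x : X) : a < value g C ->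
  \forall y \near x & n \near \oo, C_ n y -> a < g_ n y.
Proof.
move=> av; have [Cx|] := pselect (C x); last first.
  by move=> /C_limsup; apply: filterS => -[y n] /= nC /nC.
have agx : a < g x by apply: (lt_le_trans av); apply: ereal_inf_lbound; exists x.
have := converges_continuously_near gn_cvg (open_ereal_gt' agx).
by apply: filterS => -[y n].
Qed.

Lemma sublevel_in_compact (a : R) : exists2 K, compact K &
  \forall n \near \oo, forall y, C_ n y -> g_ n y <= a%:E -> K y.
Proof.
have [N] := gn_level_compact a; rewrite precompactE => cK.
eexists; first exact: cK.
by exists N => // n /= Nn y Cy gy; apply: subset_closure; exists n.
Qed.

(** Points of [C_ n] where [g_ n] is at most [a] eventually lie in a fixed compact set, on which the
    local bounds of [near_gt_on_C_] become uniform. *)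
Lemma near_value_ge (a : R) : a%:E < value g C ->
  \forall n \near \oo, a%:E <= value (g_ n) (C_ n).
Proof.
move=> av; have [K /compact_near_coveringP cK nK] := sublevel_in_compact a.
have nKa : \forall n \near \oo, K `<=` (fun y => C_ n y -> a%:E < g_ n y).
  by apply: cK => x _; exact: near_gt_on_C_.
apply: filterS2 nK nKa => n Kn Ka.
apply: le_ereal_inf_tmp => _ [y Cy <-]; rewrite leNgt; apply/negP => gya.
have := Ka y (Kn y Cy (ltW gya)) Cy.
by rewrite ltNge (ltW gya).
Qed.

(** Feasibility excludes [+oo]. A value [-oo] would give points of [C] with [g] arbitrarily
    negative, all in a compact set on which lower semicontinuity bounds [g] below. *)
Lemma value_fin_num : value g C \is a fin_num.
Proof.
have [x0 [Cx0 gx0]] := feasible.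
rewrite fin_real//; apply/andP; split; last first.
  by apply: le_lt_trans gx0; apply: ereal_inf_lbound; exists x0.
have [K /compact_near_coveringP cK nK] := sublevel_in_compact 0%R.
have [n Kn] : exists n : nat, K `<=` [set y | (- n%:R)%:E < g y].
  apply: (@filter_ex _ \oo).
  apply: (cK nat \oo (fun n y => (- n%:R)%:E < g y)) => x _.
  have [a agx] : exists a : R, a%:E < g x.
    case: (g x) (g_gtNy x) => [r _|_|//]; last by exists 0%R; rewrite ltry.
    by exists (r - 1)%R; rewrite lte_fin ltrBlDr ltrDl.
  have [V xV Va] := g_lsc agx.
  exists (V, [set n | (- a <= n%:R)%R]).
    by split => //=; exact: nbhs_infty_ger.
  move=> [y m] /= [Vy am]; apply: le_lt_trans (Va _ Vy).
  by rewrite lee_fin lerNl.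
rewrite ltNye; apply/negP => /eqP vNy.
have := ltNyr (- n%:R : R)%R.
rewrite -vNy => /ereal_inf_lt[_ [y Cy <-] gyn].
have gy0 : g y < 0%:E.
  by apply: lt_le_trans gyn _; rewrite lee_fin oppr_le0.
(* [K] captures sublevel sets of the [g_ n] for large [n], not of [g], so [y] is placed in [K]
   through some [g_ m y < 0]. *)
have ngy : \forall n \near \oo, g_ n y < 0 by exact: cvg_pointwise (open_ereal_lt' gy0).
have [m [/(_ y (C_sub m Cy)) + /ltW gm]] := @filter_ex _ \oo _ _ (filterI nK ngy).
move=> /(_ gm)/Kn /=.
by rewrite ltNge (ltW gyn).
Qed.

Lemma cvg_value : value (g_ n) (C_ n) @[n --> \oo] --> value g C.
Proof.
rewrite -(fineK value_fin_num); set v := fine _.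
have vE : value g C = v%:E by rewrite fineK ?value_fin_num.
move=> W /nbhs_EFin /nbhs_ballP[e /= e0 eW].
have e2 : (0 < e / 2)%R by rewrite divr_gt0.
have /near_value_ge : (v - e / 2)%:E < value g C.
  by rewrite vE lte_fin ltrBlDr ltrDl.
have /near_value_lt : value g C < (v + e / 2)%:E by rewrite vE lte_fin ltrDl.
apply: filterS2 => n /=; case: (value _ _) => [r||] //.
rewrite lte_fin lee_fin => rv vr; apply: eW; rewrite /ball/= ltr_distlC.
have e2e : (e / 2 < e)%R by rewrite ltr_pdivrMr// ltr_pMr// ltr1n.
apply/andP; split; first by apply: lt_le_trans vr; rewrite ltrD2l ltrN2.
by apply: lt_trans rv _; rewrite ltrD2l.
Qed.

Lemma near_value_fin_num :
  \forall n \near \oo, value (g_ n) (C_ n) \is a fin_num.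
Proof.
have := cvg_value; rewrite -(fineK value_fin_num) => /fine_cvgP[+ _].
by [].
Qed.

(** The limit of the values is finite, so the values are eventually finite and the [-oo] branch of
    [eps_value] is avoided. *)
Lemma cvg_eps_value (e_ : nat -> R) (e : R) : e_ n @[n --> \oo] --> e ->
  eps_value (e_ n) (g_ n) (C_ n) @[n --> \oo] --> value g C + e%:E.
Proof.
move=> cvge.
have : value (g_ n) (C_ n) + (e_ n)%:E @[n --> \oo] --> value g C + e%:E.
  apply: cvgeD; [by rewrite fin_num_adde_defl|exact: cvg_value|].
  by apply: cvg_EFin; [exact: nearW|exact: cvge].
apply: cvg_trans; apply: near_eq_cvg.
near=> n; rewrite /eps_value ifF//; apply/negbTE.
suff /fin_numPlt/andP[] : value (g_ n) (C_ n) \is a fin_num by rewrite ltNye.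
by near: n; exact: near_value_fin_num.
Unshelve. all: by end_near. Qed.

(** If [g x] exceeded the limit of the thresholds, a number between them would eventually separate
    the thresholds from [g_ n] near [x]. The limit [e] covers both vanishing and constant
    tolerances. *)
Lemma PK_limsup_eps_argmin_le (e_ : nat -> R) (e : R) (x : X) :
  e_ n @[n --> \oo] --> e ->
  PK_limsup (fun n => eps_argmin (e_ n) (g_ n) (C_ n)) x ->
  C x /\ g x <= value g C + e%:E.
Proof.
move=> cvge /PK_limsupP lx; split.
  apply: contra_notP lx => /C_limsup.
  by apply: filterS => -[y n] /= nC [].
rewrite leNgt; apply/negP => vg; apply: lx.
have [a va ag] : exists2 a : \bar R, value g C + e%:E < a & a < g x.
  move: vg; rewrite -(fineK value_fin_num) -EFinD.
  case: (g x) (g_gtNy x) => [r _|_|//].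
    rewrite lte_fin => vr; exists (((fine (value g C) + e) + r) / 2)%:E.
      by rewrite lte_fin midf_lt.
    by rewrite lte_fin midf_lt.
  move=> _; exists (fine (value g C) + e + 1)%:E; last by rewrite ltry.
  by rewrite lte_fin ltrDl.
have [[V N] /= [xV nN] VN] :=
  converges_continuously_near gn_cvg (open_ereal_gt' ag).
have na : \forall n \near \oo, eps_value (e_ n) (g_ n) (C_ n) < a.
  exact: cvg_eps_value cvge _ (open_ereal_lt' va).
exists (V, N `&` [set n | eps_value (e_ n) (g_ n) (C_ n) < a]).
  by split => //=; exact: filterI.
move=> [y n] /= [Vy [Nn ena]] [_]; apply/negP; rewrite -ltNge.
by apply: lt_trans ena _; exact: (VN (y, n)).
Qed.

(** Positive tolerances provide near-minimizers that eventually lie in one compact set; were the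
    upper limit empty, compactness would eventually clear that set of near-minimizers. *)
Lemma PK_limsup_eps_argmin_nonempty (e_ : nat -> R) :
  (forall n, (0 < e_ n)%R) -> e_ n @[n --> \oo] --> (0 : R)%R ->
  PK_limsup (fun n => eps_argmin (e_ n) (g_ n) (C_ n)) !=set0.
Proof.
move=> e_gt0 cvge.
pose a := (fine (value g C) + 1)%R.
have va : value g C + 0%:E < a%:E.
  by rewrite adde0 -{1}(fineK value_fin_num) lte_fin ltrDl.
have [K /compact_near_coveringP cK nK] := sublevel_in_compact a.
apply: contrapT => none.
have nE : \forall n \near \oo,
    K `<=` (fun y => ~ eps_argmin (e_ n) (g_ n) (C_ n) y).
  apply: cK => x Kx; apply: contrapT => nx; apply: none; exists x.
  exact/PK_limsupP.
have na : \forall n \near \oo, eps_value (e_ n) (g_ n) (C_ n) < a%:E.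
  exact: cvg_eps_value cvge _ (open_ereal_lt' va).
have [n [[Kn En] [an vn]]] :=
  @filter_ex _ \oo _ _ (filterI (filterI nK nE) (filterI na near_value_fin_num)).
have [_ [y Cy <-] gy] := lb_ereal_inf_adherent (e_gt0 n) vn.
have Ey : eps_argmin (e_ n) (g_ n) (C_ n) y.
  split => //; rewrite /eps_value ifF; first exact: ltW.
  by apply/negbTE; move: vn => /fin_numPlt/andP[]; rewrite ltNye.
apply: (En y) (Ey); apply: Kn => //.
by apply: le_trans Ey.2 _; exact: ltW an.
Qed.

Lemma argmin_sub_PK_liminf (e : R) : (0 < e)%R ->
  argmin g C `<=` PK_liminf (fun n => eps_argmin e (g_ n) (C_ n)).
Proof.
move=> e0 x [Cx gx]; apply: near_mem_PK_liminf.
have xv : g x = value g C.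
  by apply/eqP; rewrite eq_le gx; apply: ereal_inf_lbound; exists x.
pose b := (value g C + (e / 2)%:E).
have bfin : b = (fine (value g C) + e / 2)%:E.
  by rewrite EFinD fineK ?value_fin_num.
have e2 : (e / 2 < e)%R by rewrite ltr_pdivrMr// ltr_pMr// ltr1n.
have gb : g x < b.
  by rewrite xv bfin -(fineK value_fin_num) lte_fin ltrDl divr_gt0.
have bv : b < value g C + e%:E.
  by rewrite bfin -{2}(fineK value_fin_num) -EFinD lte_fin ltrD2l.
have : \forall n \near \oo, b < eps_value e (g_ n) (C_ n).
  exact: cvg_eps_value (cvg_cst e) _ (open_ereal_gt' bv).
have : \forall n \near \oo, g_ n x < b by exact: cvg_pointwise (open_ereal_lt' gb).
apply: filterS2 => n /= gnb be; split; first exact: C_sub.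
by apply: ltW; exact: lt_trans be.
Qed.

(** A cycle of inclusions: from [argmin] to the lower limits, to the upper limits, and back to
    [argmin] by letting [eps] tend to 0. *)
Lemma argmin_eq_bigcap_PK_lim :
  \bigcap_(eps in [set eps : R | (0 < eps)%R])
    PK_liminf (fun n => eps_argmin eps (g_ n) (C_ n)) = argmin g C /\
  argmin g C = \bigcap_(eps in [set eps : R | (0 < eps)%R])
    PK_limsup (fun n => eps_argmin eps (g_ n) (C_ n)).
Proof.
have argmin_sub : argmin g C `<=` \bigcap_(eps in [set eps : R | (0 < eps)%R])
    PK_liminf (fun n => eps_argmin eps (g_ n) (C_ n)).
  by move=> x gx e /= e0; exact: argmin_sub_PK_liminf.
have liminf_sub : \bigcap_(eps in [set eps : R | (0 < eps)%R])
    PK_liminf (fun n => eps_argmin eps (g_ n) (C_ n)) `<=`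
    \bigcap_(eps in [set eps : R | (0 < eps)%R])
    PK_limsup (fun n => eps_argmin eps (g_ n) (C_ n)).
  by move=> x lx e e0; apply: PK_liminf_sub_limsup; exact: lx.
have limsup_sub : \bigcap_(eps in [set eps : R | (0 < eps)%R])
    PK_limsup (fun n => eps_argmin eps (g_ n) (C_ n)) `<=` argmin g C.
  move=> x lx; split.
    by have [] := PK_limsup_eps_argmin_le (e := 1%R) (@cvg_cst _ _ _ _ _) (lx _ ltr01).
  apply/lee_addgt0Pr => e e0.
  by have [] := PK_limsup_eps_argmin_le (cvg_cst e) (lx _ e0).
split; apply/seteqP; split => //.
- exact: subset_trans liminf_sub limsup_sub.
- exact: subset_trans argmin_sub liminf_sub.
Qed.

End constrained_minimization.

(** * Almost sure control of the orbit sets *)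

Section almost_sure_convergence.
Context {R : realType} {d : measure_display}.
Context {S : topologicalMeasurableType d} {X : pseudoMetricType R}.
Variables (mu : {finite_measure set S -> \bar R}) (M : S -> set X) (T : S -> S).
Hypotheses (X_separable : separable_space X)
  (open_measurable : forall U : set S, open U -> measurable U)
  (mu_strictly_positive : forall U : set S, open U -> U !=set0 -> 0 < mu U)
  (M_osc : outer_semicontinuous M)
  (T_preserving : measure_preserving mu T) (T_ergodic : ergodic mu T).

Lemma almost_sure_sub_orbit n s :
  almost_sure_set M `<=` orbit_set M T n s.
Proof. by move=> x Mx k _; exact: Mx. Qed.

(** Almost every orbit visits, at some time [k >= 1], an open set of points whose images under [M]
    miss [V]; from [n = k] on, such an image is among the sets intersected by [orbit_set]. *)
Lemma ae_avoid_set (V : set X) :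
  (exists s : S, \forall u \near s, forall y, V y -> ~ M u y) ->
  {ae mu, forall s, exists N, forall n, (N <= n)%N ->
    orbit_set M T n s `&` V = set0}.
Proof.
move=> [s /nbhs_interior sV].
pose U := [set u | forall y, V y -> ~ M u y]^°.
have [oU Us] : open U /\ U s by split; [exact: open_interior|exact: nbhs_singleton].
have : {ae mu, forall s, exists2 k, (1 <= k)%N & U (iter k T s)}.
  apply: ergodic_ae_visit => //; first exact: open_measurable.
  by apply: mu_strictly_positive => //; exists s.
apply: filterS => t [k k1 /interior_subset Vk]; exists k => n kn.
apply/seteqP; split=> // y [Iy Vy]; apply: (Vk y Vy).
by apply: Iy => /=; rewrite k1.
Qed.

(* The conclusion says that the upper limit of the sets [orbit_set M T n s] is
   contained in [almost_sure_set M] (see [PK_limsupP]). *)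
Lemma ae_orbit_PK_limsup_sub :
  {ae mu, forall s, forall x, ~ almost_sure_set M x ->
    \forall y \near x & n \near \oo, ~ orbit_set M T n s y}.
Proof.
have [D cD dD] := X_separable.
(* [V i k] is the ball of radius 1/(k+1) centered at the [i]-th point of the
   countable dense set, or empty. *)
have [f Df] : exists f : nat -> set X, forall x, D x -> exists i, f i = [set x].
  have /countable_injP[h h_inj] := cD.
  exists (fun i => [set x | D x /\ h x = i]) => x Dx; exists (h x).
  apply/seteqP; split=> [y [Dy hyx]|y ->] //=.
  by apply: h_inj => //; rewrite inE.
pose V (i k : nat) := \bigcup_(x in f i) ball x (k.+1%:R^-1 : R)%R.
pose avoidable W := exists s : S, \forall u \near s, forall y, W y -> ~ M u y.
(* The pairs [i], [k] are countable, so one null set serves all balls, before [x] is chosen. *)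
have : {ae mu, forall s, forall i k, avoidable (V i k) ->
    exists N, forall n, (N <= n)%N -> orbit_set M T n s `&` V i k = set0}.
  apply: ae_foralln => i; apply: ae_foralln => k.
  have [/ae_avoid_set|nV] := pselect (avoidable (V i k)).
    by apply: filterS => s Vs _.
  by apply: aeW => s /nV.
apply: filterS => s sV x nMx.
have [u nMux] : exists u, ~ M u x.
  by apply: contrapT => nu; apply: nMx => u _; apply: contrapT => nMu; apply: nu; exists u.
have [[W U] /= [/nbhs_ballP[e /= e0 eW] uU] WU] :=
  outer_semicontinuous_near M_osc nMux.
have e2 : (0 < e / 2)%R by rewrite divr_gt0.
(* With [1/(k+1) < e/2] and a dense point [z] within [1/(2(k+1))] of [x], the ball of radius
   [1/(k+1)] around [z] lies in [W] and is a neighborhood of [x]. *)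
have [k _ /(_ k (leqnn k)) ke] := near_infty_natSinv_lt (PosNum e2).
have r2 : (0 < k.+1%:R^-1 / 2 :> R)%R by rewrite divr_gt0// invr_gt0.
have [z [/interior_subset xz Dz]] : (ball x (k.+1%:R^-1 / 2)%R)^° `&` D !=set0.
  apply: dD; last exact: open_interior.
  by exists x; apply/nbhs_ballP; exists (k.+1%:R^-1 / 2)%R.
have [i fi] := Df z Dz.
have VE : V i k = ball z (k.+1%:R^-1)%R by rewrite /V fi bigcup_set1.
have VW : V i k `<=` W.
  rewrite VE => y zy; apply: eW; apply: (ball_split (z := z)).
    apply: le_ball xz; apply: le_trans (ltW ke).
    by rewrite ler_pdivrMr// ler_peMr// ler1n.
  exact: le_ball (ltW ke) _ zy.
have [|N VN] := sV i k.
  by exists u; apply: filterS uU => t Ut y /VW Wy; exact: (WU (y, t)).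
exists (V i k, [set n | (N <= n)%N]).
  split; last by exists N.
  apply/nbhs_ballP; exists (k.+1%:R^-1 / 2)%R => //= y xy; rewrite VE.
  by apply: (ball_split (z := x)) => //; exact: ball_sym.
move=> [y n] /= [Vy Nn] Iy.
by have : (orbit_set M T n s `&` V i k) y by []; rewrite VN.
Qed.

End almost_sure_convergence.

Theorem corollary4p3 (R : realType) (X : completeMetricType R)
    (d : measure_display) (S : topologicalMeasurableType d)
    (mu : {finite_measure set S -> \bar R})
    (M : S -> set X) (T : S -> S)
    (g : X -> \bar R) (g_ : nat -> X -> \bar R)
    (X_separable : separable_space X)
    (open_measurable : forall U : set S, open U -> measurable U)
    (mu_strictly_positive :
      forall U : set S, open U -> U !=set0 -> 0 < mu U)
    (mu_complete : measure_is_complete mu)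
    (M_osc : outer_semicontinuous M)
    (T_preserving : measure_preserving mu T)
    (T_ergodic : ergodic mu T)
    (g_gtNy : forall x, -oo < g x)
    (g_lsc : lower_semicontinuous g)
    (gn_gtNy : forall n x, -oo < g_ n x)
    (gn_lsc : forall n, lower_semicontinuous (g_ n))
    (gn_cvg : converges_continuously g_ g)
    (feasible : exists x, almost_sure_set M x /\ g x < +oo)
    (gn_level_compact : {ae mu, forall s,
      eventually_level_compact g_ (fun n => orbit_set M T n s)}) :
  [/\ {ae mu, forall s,
        value (g_ n) (orbit_set M T n s) @[n --> \oo]
          --> value g (almost_sure_set M)},
      (forall eps_ : nat -> S -> R,
        (forall n, measurable_fun [set: S] (eps_ n)) ->
        (forall n s, (0 < eps_ n s)%R) ->
        {ae mu, forall s, eps_ n s @[n --> \oo] --> (0 : R)%R} ->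
        {ae mu, forall s,
          PK_limsup (fun n => eps_argmin (eps_ n s) (g_ n) (orbit_set M T n s))
            !=set0 /\
          PK_limsup (fun n => eps_argmin (eps_ n s) (g_ n) (orbit_set M T n s))
            `<=` argmin g (almost_sure_set M)}) &
      {ae mu, forall s,
        \bigcap_(eps in [set eps : R | (0 < eps)%R])
          PK_liminf (fun n => eps_argmin eps (g_ n) (orbit_set M T n s))
          = argmin g (almost_sure_set M) /\
        argmin g (almost_sure_set M) =
        \bigcap_(eps in [set eps : R | (0 < eps)%R])
          PK_limsup (fun n => eps_argmin eps (g_ n) (orbit_set M T n s))}].
Proof.

have Mae := ae_orbit_PK_limsup_sub X_separable open_measurable
  mu_strictly_positive M_osc T_preserving T_ergodic.
have sub s n : almost_sure_set M `<=` orbit_set M T n s.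
  exact: almost_sure_sub_orbit.
split.
- apply: filterS2 Mae gn_level_compact => s Ms cs.
  exact: (cvg_value g_gtNy g_lsc gn_cvg (sub s) Ms cs feasible).
- move=> eps_ _ eps_gt0 eps_cvg.
  apply: filterS3 Mae gn_level_compact eps_cvg => s Ms cs es; split.
    exact: (PK_limsup_eps_argmin_nonempty g_gtNy g_lsc gn_cvg (sub s) Ms cs).
  move=> x /(PK_limsup_eps_argmin_le g_gtNy g_lsc gn_cvg (sub s) Ms cs feasible es).
  by rewrite adde0.
- apply: filterS2 Mae gn_level_compact => s Ms cs.
  exact: (argmin_eq_bigcap_PK_lim g_gtNy g_lsc gn_cvg (sub s) Ms cs feasible).
Qed.
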